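(* Let $\mathcal F$ be an algebraic language with no nullary symbols, $\mathbf I=([m];\mathcal F)$ a finite $\mathcal F$-algebra, and $k\ge1$. (1) For every $k$-ary $\hat{\mathcal F}_{\mathbf I}$-term $T$ there are $mk$-ary $\mathcal F$-terms $t^{(1)},\dots,t^{(m)}$ such that (i) $t^{(i)}(\mathbf e_{m\times k})=i$ in $\mathbf I$ for all $i\in[m]$, and (ii) for every $\mathcal F$-algebra $\mathbf A$ with surjective homomorphism $\chi\colon\mathbf A\to\mathbf I$, in $\mathbf C=\mathfrak C(\mathbf A,\chi)$ we have $T(\mathbf a)=(t^{(1)}(\mathbf a),\dots,t^{(m)}(\mathbf a))$ for every $m\times k$ matrix $\mathbf a\in C^k$, where $T$ is applied to the $k$ columns and each $t^{(i)}$ to the $mk$ entries of $\mathbf a$. (2) Conversely, if $t^{(1)},\dots,t^{(m)}$ are $mk$-ary $\mathcal F$-terms satisfying (i), then there is a $k$-ary $\hat{\mathcal F}_{\mathbf I}$-term $T$ satisfying (ii).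
   Context: $[m]=\{1,\dots,m\}$; $\mathbf e_{m\times k}$ is the $m\times k$ matrix over $[m]$ whose $i$-th row is $(i,\dots,i)$ (the terms are evaluated entrywise in $\mathbf I$ in the same entry order as in (ii)). $\hat{\mathcal F}_{\mathbf I}$ has an $m$-ary symbol $d$ and for each $k$-ary $f\in\mathcal F$ and $\mathbf i=(i_1,\dots,i_k)\in[m]^k$ a $k$-ary symbol $\hat f_{\mathbf i}$. With $D^{(i)}=\chi^{-1}(i)$, $\mathfrak C(\mathbf A,\chi)$ has universe $C=D^{(1)}\times\dots\times D^{(m)}$ (columns), $d(\mathbf c_1,\dots,\mathbf c_m)=(c_1^{(1)},\dots,c_m^{(m)})$, and $\hat f_{\mathbf i}(\mathbf c_1,\dots,\mathbf c_k)$ is $\mathbf c_1$ with its $f^{\mathbf I}(\mathbf i)$-th entry replaced by $f^{\mathbf A}(c_1^{(i_1)},\dots,c_k^{(i_k)})$. *)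

(* Defs.v *)
From HB Require Import structures.
From mathcomp Require Import all_boot all_order all_algebra.
Set Implicit Arguments.
Unset Strict Implicit.
Unset Printing Implicit Defensive.

(* Tuples are finite functions, so that equality of tuples over an arbitrary  *)
(* type is pointwise equality.                                                *)

Record language := Language { symbol :> Type; arity : symbol -> nat }.

Definition no_nullary (F : language) := forall f : F, 0 < arity f.

Definition ops (F : language) (X : Type) :=
  forall f : F, {ffun 'I_(arity f) -> X} -> X.

Record algebra (F : language) :=
  Alg { carrier :> Type; op : ops F carrier }.

Record algebra_hom (F : language) (A B : algebra F) := AlgebraHom {
  hom_map :> A -> B;
  hom_mapE : forall (f : F) (x : {ffun 'I_(arity f) -> A}),
    hom_map (op x) = op [ffun l => hom_map (x l)] }.

Definition surj (X Y : Type) (g : X -> Y) := forall y, exists x, g x = y.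

(* [term F n] is the type of n-ary terms: the variables are indexed by 'I_n.  *)
Inductive term (F : language) (n : nat) :=
| Var of 'I_n
| App (f : F) of ('I_(arity f) -> term F n).

Fixpoint eval (F : language) (A : algebra F) (n : nat) (t : term F n)
    (x : {ffun 'I_n -> A}) : A :=
  match t with
  | Var i => x i
  | App f s => op [ffun l => eval (s l) x]
  end.

(* [m] is represented by 'I_m, i.e. {0, ..., m-1}.                            *)

Inductive hat_symbol (F : language) (m : nat) :=
| HatD
| HatF (f : F) of {ffun 'I_(arity f) -> 'I_m}.
Arguments HatD {F m}.

Definition hat_arity (F : language) (m : nat) (s : hat_symbol F m) : nat :=
  match s with HatD => m | HatF f _ => arity f end.

Definition hat (F : language) (m : nat) : language :=
  Language (@hat_arity F m).

Section HatAlgebra.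

Variables (F : language) (F_gt0 : no_nullary F) (m : nat) (I : ops F 'I_m).
Variables (A : algebra F) (chi : algebra_hom A (Alg I)).

(* The universe D^(1) x ... x D^(m), where D^(i) = chi^-1(i).                 *)
Definition is_column (c : {ffun 'I_m -> A}) : bool :=
  [forall i : 'I_m, (chi (c i) : 'I_m) == i].

Definition column := {c : {ffun 'I_m -> A} | is_column c}.

Definition diag_fun (c : {ffun 'I_m -> column}) : {ffun 'I_m -> A} :=
  [ffun i => val (c i) i].

Lemma diag_fun_subproof c : is_column (diag_fun c).
Proof. by apply/forallP => i; rewrite ffunE (forallP (valP (c i)) i). Qed.

Definition diag_op (c : {ffun 'I_m -> column}) : column :=
  exist (fun x => is_true (is_column x)) _ (diag_fun_subproof c).

(* [Ordinal (F_gt0 f)] is the first argument position of f.                   *)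
Definition repl_fun (f : F) (i : {ffun 'I_(arity f) -> 'I_m})
    (c : {ffun 'I_(arity f) -> column}) : {ffun 'I_m -> A} :=
  [ffun j => if j == I i then op [ffun l => val (c l) (i l)]
             else val (c (Ordinal (F_gt0 f))) j].

Lemma repl_fun_subproof f (i : {ffun 'I_(arity f) -> 'I_m}) c :
  is_column (repl_fun i c).
Proof.
apply/forallP => j; rewrite ffunE; case: (eqVneq j (I i)) => [->|_].
  rewrite hom_mapE /=; apply/eqP; congr (I _); apply/ffunP => l.
  by rewrite !ffunE; exact/eqP/(forallP (valP (c l))).
by rewrite (forallP (valP (c (Ordinal (F_gt0 f)))) j).
Qed.

Definition repl_op (f : F) (i : {ffun 'I_(arity f) -> 'I_m})
    (c : {ffun 'I_(arity f) -> column}) : column :=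
  exist (fun x => is_true (is_column x)) _ (repl_fun_subproof i c).

Definition hat_ops : ops (hat F m) column := fun s =>
  match s return {ffun 'I_(hat_arity s) -> column} -> column with
  | HatD => diag_op
  | HatF f i => repl_op i
  end.

Definition hat_algebra : algebra (hat F m) := Alg hat_ops.

Definition columns_mx (k : nat) (a : {ffun 'I_k -> hat_algebra}) :
    'M[A]_(m, k) :=
  \matrix_(i, j) val (a j) i.

End HatAlgebra.

(* The entries of a matrix, listed row by row.                                *)
Definition entries (X : Type) (m k : nat) (M : 'M[X]_(m, k)) :
    {ffun 'I_(m * k) -> X} :=
  [ffun j => mxvec M ord0 j].

Definition e_mx (m k : nat) : 'M['I_m]_(m, k) := \matrix_(i, j) i.

Definition fixes_e (F : language) (m : nat) (I : ops F 'I_m) (k : nat)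
    (t : 'I_m -> term F (m * k)) : Prop :=
  forall i : 'I_m,
    eval (A := Alg I) (t i) (entries (e_mx m k)) = i.

Definition represents (F : language) (F_gt0 : no_nullary F) (m : nat)
    (I : ops F 'I_m) (k : nat) (T : term (hat F m) k)
    (t : 'I_m -> term F (m * k)) : Prop :=
  forall (A : algebra F) (chi : algebra_hom A (Alg I)), surj chi ->
  forall a : {ffun 'I_k -> hat_algebra F_gt0 chi},
    val (eval T a) = [ffun i => eval (t i) (entries (columns_mx a))].

(* Main.v *)
Require Import Defs.
From HB Require Import structures.
From mathcomp Require Import all_boot all_order all_algebra.
Set Implicit Arguments.
Unset Strict Implicit.
Unset Printing Implicit Defensive.

(* (1) The t^(i) are read off T symbol by symbol, following the definition of *)
(* the operations of C(A, chi).                                               *)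
(* (2) For each mk-ary term s, replacing every subterm f(s_1, ..., s_n) by    *)
(* \hat f_i(S_1, ..., S_n), where i_l is the value of s_l at e, gives a k-ary *)
(* term S such that, in every C(A, chi), the entry of S(a) in row s(e) is     *)
(* s(a).  Applying d to the terms S obtained from t^(1), ..., t^(m) gives T,  *)
(* because t^(i)(e) = i.                                                      *)

Lemma entriesE (X : Type) (m k : nat) (M : 'M[X]_(m, k)) i j :
  entries M (mxvec_index i j) = M i j.
Proof. by rewrite ffunE mxvecE. Qed.

Section Rows.

Variables (F : language) (F_gt0 : no_nullary F) (m : nat) (I : ops F 'I_m).
Variable k : nat.

(** The recursive calls are passed to the match as an argument, so that [hat_arity s] reduces in
    each branch. *)
Fixpoint row_term (T : term (hat F m) k) (r : 'I_m) : term F (m * k) :=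
  match T with
  | Var j => Var F (mxvec_index r j)
  | App s args =>
    match s return ('I_(hat_arity s) -> 'I_m -> term F (m * k)) -> _ with
    | HatD => fun t => t r r
    | HatF f i => fun t =>
        if r == I i then App (fun l => t l (i l)) else t (Ordinal (F_gt0 f)) r
    end (fun l => row_term (args l))
  end.

Lemma row_term_fixes_e (T : term (hat F m) k) : fixes_e I (row_term T).
Proof.
elim: T => [j|[|f i] args IH] r /=; first by rewrite entriesE mxE.
  exact: IH.
case: (eqVneq r (I i)) => [->|_] /=; last exact: IH.
(* By induction the argument at position [l], read in row [i l], takes the value [i l] at e. *)
by congr (I _); apply/ffunP => l; rewrite ffunE; exact: IH.
Qed.

Lemma row_term_represents (T : term (hat F m) k) :
  represents F_gt0 I T (row_term T).
Proof.
move=> A chi _ a; apply/ffunP => r; rewrite ffunE.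
elim: T r => [j|[|f i] args IH] r /=; first by rewrite entriesE mxE.
  by rewrite ffunE ffunE; exact: IH.
rewrite ffunE; case: (eqVneq r (I i)) => [_|_] /=.
  by congr (op _); apply/ffunP => l; rewrite !ffunE; exact: IH.
by rewrite ffunE; exact: IH.
Qed.

(** The indices are computed in [I] alone, so one [S] serves all algebras over [I]. *)
Lemma hat_term_of_term (s : term F (m * k)) :
  exists S : term (hat F m) k,
    forall (A : algebra F) (chi : algebra_hom A (Alg I))
           (a : {ffun 'I_k -> hat_algebra F_gt0 chi}),
      val (eval S a) (eval (A := Alg I) s (entries (e_mx m k))) =
      eval s (entries (columns_mx a)).
Proof.
elim: s => [v|f args /fin_all_exists[S S_P]].
  case/mxvec_indexP: v => i j; exists (Var _ j) => A chi a /=.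
  by rewrite !entriesE !mxE.
pose i := [ffun l => eval (A := Alg I) (args l) (entries (e_mx m k))].
exists (@App (hat F m) k (HatF i) S) => A chi a /=.
(* The row read is the value of [App f args] at e, which is [I i]: exactly the row that [HatF i]
   overwrites. *)
rewrite ffunE eqxx; congr (op _); apply/ffunP => l.
by rewrite !ffunE; exact: S_P.
Qed.

End Rows.

Theorem theorem3p8 (F : language) (F_gt0 : no_nullary F) (m : nat)
    (I : ops F 'I_m) (k : nat) (k_gt0 : 1 <= k) :
  (forall T : term (hat F m) k,
     exists t : 'I_m -> term F (m * k),
       fixes_e I t /\ represents F_gt0 I T t) /\
  (forall t : 'I_m -> term F (m * k),
     fixes_e I t ->
     exists T : term (hat F m) k, represents F_gt0 I T t).
Proof.
split=> [T|t t_e].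
  exists (row_term F_gt0 I T).
  by split; [exact: row_term_fixes_e | exact: row_term_represents].
have /fin_all_exists[S S_P] i := hat_term_of_term F_gt0 I (t i).
exists (@App (hat F m) k HatD S) => A chi _ a.
by apply/ffunP => i; rewrite !ffunE -S_P t_e.
Qed.
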